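(* Let $f$ be a nonnegative continuous function on $\mathbb{Q}_p^N\setminus\{0\}$ defining a positive-definite distribution, with $f=\mathcal{F}\mu$ for a regular Borel measure $\mu$ on $\mathbb{Q}_p^N$, and let $d\ge1$ be an integer and $\beta>0$. Then \[ \int_{\mathbb{Q}_p^N}\frac{d\mu(\xi)}{\max(1,\|\xi\|_p)^{d\beta}}<+\infty \] if and only if \[ \begin{cases} \dfrac{1-p^{-d\beta}}{1-p^{d\beta-N}}\displaystyle\int_{\|x\|_p\le1}\left(\|x\|_p^{d\beta-N}-p^{d\beta-N}\right)f(x)\,d^Nx<+\infty & \text{if } d\beta\ne N,\\[2ex] (1-p^{-N})\displaystyle\int_{\|x\|_p\le1}\log_p\left(\frac{p}{\|x\|_p}\right)f(x)\,d^Nx<+\infty & \text{if } d\beta=N. \end{cases} \]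
   Context: $p$ is a prime, $\mathbb{Q}_p$ the $p$-adic numbers, $\|x\|_p=\max_i|x_i|_p$ on $\mathbb{Q}_p^N$, $d^Nx$ Haar measure with $\mathbb{Z}_p^N$ of measure 1. Fourier transform $(\mathcal{F}\varphi)(\xi)=\int\chi_p(-\xi\cdot x)\varphi(x)d^Nx$ with $\chi_p(y)=\exp(2\pi i\{y\}_p)$, extended to distributions (and measures) by duality on the space of locally constant compactly supported test functions. A distribution $F$ is positive-definite if $(F,\overline{\varphi*\widetilde\varphi})\ge0$ for all test functions $\varphi$, where $\widetilde\varphi(x)=\overline{\varphi(-x)}$. *)

(* Defs.v *)
From HB Require Import structures.
From mathcomp Require Import all_boot all_order all_algebra.
From mathcomp Require Import all_classical all_reals all_analysis.
From mathcomp Require Import complex.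
Set Implicit Arguments.
Unset Strict Implicit.
Unset Printing Implicit Defensive.
Import Order.TTheory GRing.Theory Num.Theory.
Import numFieldNormedType.Exports.
Local Open Scope classical_set_scope.
Local Open Scope ring_scope.
Local Open Scope complex_scope.

(* The field Q_p, given abstractly: a field K of characteristic 0 with *)
(* an absolute value absp which is ultrametric, normalised by          *)
(* |p| = 1/p, complete, and in which Q is dense.  This characterises   *)
(* (K, absp) up to isometric isomorphism as the p-adic numbers Q_p     *)
(* with |.|_p (Ostrowski + uniqueness of completions).                 *)
Definition qp_is_Qp (R : realType) (K : fieldType) (p : nat) (absp : K -> R) : Prop :=
  prime p /\ [pchar K] =i pred0 /\
      (forall x, 0 <= absp x) /\ (forall x, absp x = 0 <-> x = 0) /\
      (forall x y, absp (x * y) = absp x * absp y) /\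
      (forall x y, absp (x + y) <= Num.max (absp x) (absp y)) /\
      absp (p%:R) = (p%:R)^-1 /\
      (forall u : nat -> K,
         (forall e : R, 0 < e -> exists n, forall m k, (n <= m)%N -> (n <= k)%N ->
              absp (u m - u k) < e) ->
         exists l, forall e : R, 0 < e -> exists n, forall m, (n <= m)%N ->
              absp (u m - l) < e) /\
      (forall (x : K) (e : R), 0 < e -> exists q : rat, absp (x - ratr q) < e).

Section VecK.
Variables (K : fieldType) (N : nat).
Definition qp_vecK := 'I_N -> K.
HB.instance Definition _ := Choice.on qp_vecK.
HB.instance Definition _ := isPointed.Build qp_vecK (fun _ => (0 : K)).
End VecK.

Section Padic.
Variables (R : realType) (K : fieldType) (p : nat) (absp : K -> R) (N : nat).

Local Notation V := (qp_vecK K N).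

Definition qp_vadd (x y : V) : V := fun i => x i + y i.
Definition qp_vopp (x : V) : V := fun i => - x i.
Definition qp_vsub (x y : V) : V := fun i => x i - y i.
Definition qp_vdot (x y : V) : K := \sum_(i < N) x i * y i.

Definition qp_normp (x : V) : R := \big[Num.max/0]_(i < N) absp (x i).

Definition qp_openp (U : set V) : Prop :=
  forall x, U x -> exists2 e : R, 0 < e & forall y, qp_normp (qp_vsub y x) < e -> U y.

Definition qp_compactp (A : set V) : Prop :=
  forall F : set (set V), (forall U, F U -> qp_openp U) ->
    A `<=` \bigcup_(U in F) U ->
    exists2 G : set (set V), finite_set G /\ G `<=` F & A `<=` \bigcup_(U in G) U.

End Padic.

Notation qp_QpN R K absp N := (g_sigma_algebraType (@qp_openp R K absp N)).

Section Padic2.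
Variables (R : realType) (K : fieldType) (p : nat) (absp : K -> R) (N : nat).

Local Notation V := (qp_QpN R K absp N).
Local Notation qp_normp := (@qp_normp R K absp N).
Local Notation qp_openp := (@qp_openp R K absp N).
Local Notation qp_compactp := (@qp_compactp R K absp N).

Definition qp_vzero : V := fun _ => 0.

Definition qp_continuous_off0 (f : V -> R) : Prop :=
  forall x, x <> qp_vzero -> forall e : R, 0 < e ->
    exists2 dl : R, 0 < dl & forall y, qp_normp (qp_vsub y x) < dl -> `|f y - f x| < e.

Definition qp_regular_measure (mu : {measure set V -> \bar R}) : Prop :=
  [/\ (forall A, qp_compactp A -> (mu A < +oo)%E),
      (forall A, measurable A ->
         mu A = ereal_inf [set mu U | U in [set U | qp_openp U /\ A `<=` U]])
    & (forall U, qp_openp U ->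
         mu U = ereal_sup [set mu C | C in [set C | qp_compactp C /\ C `<=` U]])].

Definition qp_haar_measure (lam : {measure set V -> \bar R}) : Prop :=
  [/\ qp_regular_measure lam,
      (forall (A : set V) (a : V), measurable A ->
         lam [set qp_vadd x a | x in A] = lam A)
    & lam [set x | qp_normp x <= 1] = 1%E].

Definition qp_Cint (mu : {measure set V -> \bar R}) (D : set V) (g : V -> R[i]) : R[i] :=
  Complex (Rintegral mu D (fun x => complex.Re (g x))) (Rintegral mu D (fun x => complex.Im (g x))).

(* fractional part {y}_p : the unique m / p^k in [0,1) with y - m/p^k in Z_p *)
Definition qp_fracp (y : K) : R :=
  xget 0 [set r : R | exists m k : nat, [/\ r = m%:R / (p ^ k)%:R, (m < p ^ k)%N &
                                         absp (y - m%:R / (p ^ k)%:R) <= 1]].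

Definition qp_chip (y : K) : R[i] :=
  Complex (cos (2 * pi * qp_fracp y)) (sin (2 * pi * qp_fracp y)).

Definition qp_testfun (phi : V -> R[i]) : Prop :=
  (forall x, exists2 e : R, 0 < e &
       forall y, qp_normp (qp_vsub y x) < e -> phi y = phi x) /\
  (exists2 C : set V, qp_compactp C & forall x, ~ C x -> phi x = 0).

Section WithHaar.
Variable lam : {measure set V -> \bar R}.

Definition qp_fourier (phi : V -> R[i]) (xi : V) : R[i] :=
  qp_Cint lam setT (fun x => qp_chip (- qp_vdot xi x) * phi x).

Definition qp_conv (phi psi : V -> R[i]) (x : V) : R[i] :=
  qp_Cint lam setT (fun y => phi y * psi (qp_vsub x y)).

Definition qp_tildef (phi : V -> R[i]) (x : V) : R[i] := conjc (phi (qp_vopp x)).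

Definition qp_pair_fun (f : V -> R) (phi : V -> R[i]) : R[i] :=
  qp_Cint lam setT (fun x => (f x)%:C * phi x).

Definition qp_locally_integrable (f : V -> R) : Prop :=
  forall C : set V, qp_compactp C -> measurable C -> lam.-integrable C (fun x => (f x)%:E).

Definition qp_posdef_fun (f : V -> R) : Prop :=
  forall phi, qp_testfun phi -> 0 <= qp_pair_fun f (fun x => conjc (qp_conv phi (qp_tildef phi) x)).

Definition qp_is_fourier_of_measure (f : V -> R) (mu : {measure set V -> \bar R}) : Prop :=
  forall phi, qp_testfun phi -> qp_pair_fun f phi = qp_Cint mu setT (qp_fourier phi).

End WithHaar.
End Padic2.

(* Main.v *)
(* Both sides are equal, not merely simultaneously finite. Let [alpha = d * beta], let [B n] be the
   ball of radius [p ^ -n] and [B' n] the ball of radius [p ^ n]. The Fourier transform of the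
   indicator of [B n] is [p ^ -(n N)] times the indicator of [B' n], so [f = F mu] gives
   [int_(B n) f = p ^ -(n N) * mu (B' n)]. With [a n = (1 - p ^ -alpha) * p ^ (n (N - alpha))] one has
   [max 1 |xi| ^ -alpha = sum_n a n * p ^ -(n N) * 1_(B' n)] and, off the origin of the unit ball,
   [sum_n a n * 1_(B n)] is the kernel on the right-hand side; integrate both series termwise. *)
Require Import Defs.
From HB Require Import structures.
From mathcomp Require Import all_boot all_order all_algebra.
From mathcomp Require Import all_classical all_reals all_analysis.
From mathcomp Require Import complex ring lra zify.
From mathcomp Require Import measurable_realfun.
Import Order.TTheory GRing.Theory Num.Theory.
Import numFieldNormedType.Exports.
Local Open Scope classical_set_scope.
Local Open Scope ring_scope.
Set Implicit Arguments.
Unset Strict Implicit.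

(** * Absolute value of [Q_p]: value group and residues modulo [p ^ k] *)

Section PadicField.
Variables (R : realType) (K : fieldType) (p : nat) (absp : K -> R).
Hypothesis HQp : qp_is_Qp p absp.

(** The coefficients come from telescoping: with [s = p ^ -alpha], [s ^ m] is the tail over [n >= m]
    of [(1 - s) * s ^ n], and the value group is discrete, so membership in a ball is a comparison
    of exponents. Compensating the factor [p ^ -(n N)] of the ball duality makes [a n] geometric of
    ratio [q = p ^ (N - alpha)]; the two cases of the statement are the two closed forms of a finite
    geometric sum, for [q <> 1] and [q = 1]. All [a n] are nonnegative, so termwise integration is
    monotone convergence and the equality of both sides holds in the extended reals, whether or not
    they are finite. Two points need care: for [alpha > N] the kernel and its prefactor are both
    negative and only their product has a sign; and neither the sign of [f] nor the series for the
    kernel is available at the origin, which is discarded as a null set because [N > 0]. The field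
    is only axiomatised, so residues, compactness of balls, their Haar measure and a nontrivial
    value of the character all have to be derived from the axioms. *)

Lemma prime_residue_char : prime p. Proof. by case: HQp. Qed.
Local Notation p_prime := prime_residue_char.

Lemma absp_ge0 x : 0 <= absp x. Proof. by case: HQp => _ [_ [h _]]. Qed.

Lemma absp_eq0 x : (absp x == 0) = (x == 0).
Proof.
case: HQp => _ [_ [_ [h _]]].
by apply/eqP/eqP => /h.
Qed.

Lemma abspM x y : absp (x * y) = absp x * absp y.
Proof. by case: HQp => _ [_ [_ [_ [h _]]]]. Qed.

Lemma abspD_max x y : absp (x + y) <= Num.max (absp x) (absp y).
Proof. by case: HQp => _ [_ [_ [_ [_ [h _]]]]]. Qed.

Lemma absp_p : absp p%:R = p%:R^-1.
Proof. by case: HQp => _ [_ [_ [_ [_ [_ [h _]]]]]]. Qed.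

Lemma absp_complete (u : nat -> K) :
  (forall e : R, 0 < e -> exists n, forall m k, (n <= m)%N -> (n <= k)%N ->
     absp (u m - u k) < e) ->
  exists l, forall e : R, 0 < e -> exists n, forall m, (n <= m)%N -> absp (u m - l) < e.
Proof. by case: HQp => _ [_ [_ [_ [_ [_ [_ [h _]]]]]]]; apply: h. Qed.

Lemma absp_dense x (e : R) : 0 < e -> exists q : rat, absp (x - ratr q) < e.
Proof. by case: HQp => _ [_ [_ [_ [_ [_ [_ [_ h]]]]]]]; apply: h. Qed.

Lemma p_gt0 : 0 < p%:R :> R. Proof. by rewrite ltr0n prime_gt0 ?p_prime. Qed.
Lemma p_gt1 : 1 < p%:R :> R. Proof. by rewrite ltr1n prime_gt1 ?p_prime. Qed.
Lemma p_neq0 : p%:R != 0 :> R. Proof. by rewrite gt_eqF ?p_gt0. Qed.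

Lemma natK_eq0 n : (n%:R == 0 :> K) = (n == 0%N).
Proof. by case: HQp => _ [/pcharf0P ->]. Qed.

Lemma pK_neq0 : p%:R != 0 :> K.
Proof. by rewrite natK_eq0 -lt0n prime_gt0 ?p_prime. Qed.

Lemma absp_gt0 x : (0 < absp x) = (x != 0).
Proof. by rewrite lt_def absp_ge0 absp_eq0 andbT. Qed.

Lemma absp0 : absp 0 = 0. Proof. by apply/eqP; rewrite absp_eq0. Qed.

Lemma absp1 : absp 1 = 1.
Proof.
have h : absp 1 != 0 by rewrite absp_eq0 oner_eq0.
by apply: (mulIf h); rewrite -abspM !mul1r.
Qed.

Lemma abspN x : absp (- x) = absp x.
Proof.
suff h : absp (-1) = 1 by rewrite -mulN1r abspM h mul1r.
have : absp (-1) ^+ 2 = 1 by rewrite expr2 -abspM mulrNN mul1r absp1.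
by move/eqP; rewrite sqrf_eq1 => /orP[/eqP//|/eqP h]; move: (absp_ge0 (-1)); rewrite h ler0N1.
Qed.

Lemma abspB x y : absp (x - y) = absp (y - x).
Proof. by rewrite -abspN opprB. Qed.

Lemma abspD_le x y r : absp x <= r -> absp y <= r -> absp (x + y) <= r.
Proof. by move=> hx hy; rewrite (le_trans (abspD_max x y))// ge_max hx. Qed.

Lemma abspD_lt x y r : absp x < r -> absp y < r -> absp (x + y) < r.
Proof. by move=> hx hy; rewrite (le_lt_trans (abspD_max x y))// gt_max hx. Qed.

Lemma abspB_le x y r : absp x <= r -> absp y <= r -> absp (x - y) <= r.
Proof. by move=> hx hy; apply: abspD_le; rewrite ?abspN. Qed.

Lemma abspV x : absp x^-1 = (absp x)^-1.
Proof.
have [->|x0] := eqVneq x 0; first by rewrite invr0 absp0 invr0.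
have h : absp x != 0 by rewrite absp_eq0.
by apply: (mulIf h); rewrite -abspM !mulVf// absp1.
Qed.

Lemma abspX x n : absp (x ^+ n) = absp x ^+ n.
Proof. by elim: n => [|n IH]; rewrite ?expr0 ?absp1// !exprS abspM IH. Qed.

Lemma absp_pX n : absp (p%:R ^+ n) = p%:R ^- n.
Proof. by rewrite abspX absp_p exprVn. Qed.

Lemma absp_nat_le1 n : absp n%:R <= 1.
Proof.
elim: n => [|n IH]; first by rewrite absp0 ler01.
by rewrite -natr1 abspD_le ?absp1.
Qed.

Lemma absp_int (a : int) : absp a%:~R = absp `|a|%N%:R.
Proof.
case: a => n; first by rewrite absz_nat.
by rewrite NegzE abszN rmorphN /= abspN.
Qed.

Lemma absp_int_le1 (a : int) : absp a%:~R <= 1.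
Proof. by rewrite absp_int absp_nat_le1. Qed.

(** By Bezout [1] is a combination of [p] and [n] with integer coefficients; if [absp n%:R < 1],
    both terms would have absolute value below 1, and so would their sum. *)
Lemma absp_coprime n : coprime p n -> absp n%:R = 1.
Proof.
move=> cop; apply/eqP; rewrite eq_le absp_nat_le1 /= leNgt; apply/negP => n1.
have [u v e _] := egcdnP n (prime_gt0 p_prime).
move: cop; rewrite /coprime => /eqP cop.
have : (1 : K) = u%:R * p%:R - v%:R * n%:R.
  by rewrite -!natrM e cop natrD addrAC subrr add0r.
move=> /(congr1 absp); rewrite absp1 => /esym/eqP; apply/negP.
rewrite lt_eqF// abspD_lt ?abspN// abspM.
  by rewrite (le_lt_trans (ler_wpM2r (absp_ge0 _) (absp_nat_le1 u)))// mul1r absp_p invf_lt1 ?p_gt0 ?p_gt1.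
by rewrite (le_lt_trans (ler_wpM2r (absp_ge0 _) (absp_nat_le1 v)))// mul1r.
Qed.

Lemma absp_nat n : (0 < n)%N -> absp n%:R = p%:R ^- logn p n.
Proof.
move=> n0; have [m cop e] := pfactor_coprime p_prime n0.
by rewrite {1}e natrM abspM natrX absp_pX absp_coprime// mul1r.
Qed.

Lemma pX_dvd_of_absp_le (a : int) k : absp a%:~R <= p%:R ^- k -> (p ^ k %| `|a|)%N.
Proof.
rewrite absp_int; have [->//|a0] := posnP `|a|%N.
rewrite absp_nat// pfactor_dvdn ?p_prime// lef_pV2 ?posrE ?exprn_gt0 ?p_gt0//.
by rewrite ler_eXn2l ?p_gt1.
Qed.

Lemma absp_ratr (q : rat) :
  absp (ratr q) = absp `|numq q|%N%:R / absp `|denq q|%N%:R.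
Proof. by rewrite /ratr abspM abspV !absp_int. Qed.

(** Density gives a rational closer to [x] than [absp x]; by the ultrametric inequality it has the
    same absolute value as [x], and for a rational this is a power of [p] read off the numerator and
    denominator. *)
Lemma absp_expz x : x != 0 -> exists z : int, absp x = p%:R ^ z.
Proof.
move=> x0; have [|q hq] := @absp_dense x (absp x); first by rewrite absp_gt0.
have qx : absp x = absp (ratr q).
  apply/eqP; rewrite eq_le; apply/andP; split.
    rewrite leNgt; apply/negP => h.
    have := abspD_lt hq h; rewrite subrK.
    by rewrite ltxx.
  have -> : ratr q = x - (x - ratr q) by rewrite opprB addrC subrK.
  by rewrite abspB_le// ltW.
have q0 : q != 0.
  by apply: contraNneq x0 => q0; rewrite -absp_eq0 qx absp_ratr q0 absp0 mul0r.
rewrite qx absp_ratr !absp_nat ?absz_gt0 ?denq_neq0 ?numq_eq0// invrK.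
exists (- (logn p `|numq q|)%:Z + (logn p `|denq q|)%:Z).
by rewrite expfzDr ?p_neq0// -exprnN.
Qed.

(** The integers are dense in [Z_p]: replace [z] by a nearby rational, whose denominator is then
    prime to [p], and invert that denominator modulo [p ^ k]. *)
Lemma exists_residue k z : absp z <= 1 ->
  exists2 m, (m < p ^ k)%N & absp (z - m%:R) <= p%:R ^- k.
Proof.
move=> z1; have pk0 : 0 < (p%:R : R) ^- k by rewrite invr_gt0 exprn_gt0 ?p_gt0.
have pk1 : (p%:R : R) ^- k <= 1 by rewrite invf_le1 ?exprn_gt0 ?p_gt0// exprn_ege1 ?ltW ?p_gt1.
have [q hq] := absp_dense z pk0.
have q1 : absp (ratr q) <= 1.
  have -> : ratr q = z - (z - ratr q) by rewrite opprB addrC subrK.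
  by rewrite abspB_le// (le_trans (ltW hq)).
have den0 : (0 < `|denq q|)%N by rewrite absz_gt0 denq_neq0.
(* If [p] divided the denominator, the numerator would be prime to [p] and [q] would have absolute
   value above 1. *)
have cop : coprime p `|denq q|.
  rewrite prime_coprime ?p_prime//; apply/negP => pd.
  have pn : coprime p `|numq q|.
    rewrite coprime_sym; apply: coprime_dvdr pd _; exact: coprime_num_den.
  move: q1; rewrite absp_ratr (absp_coprime pn) mul1r invf_le1 ?absp_gt0 ?natK_eq0 -?lt0n//.
  rewrite leNgt => /negP; apply; case/dvdnP: pd => c ->.
  rewrite natrM abspM (le_lt_trans (ler_wpM2r (absp_ge0 _) (absp_nat_le1 c)))//.
  by rewrite mul1r absp_p invf_lt1 ?p_gt0 ?p_gt1.
(* Here [u] is the inverse of the denominator modulo [p ^ k], so the residue sought is [numq q * u]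
   reduced modulo [p ^ k]. *)
have [u v e _] := egcdnP (p ^ k) den0.
have /eqP g1 : coprime `|denq q| (p ^ k) by rewrite coprime_sym coprimeXl.
rewrite g1 in e.
pose P : int := (p ^ k)%:Z.
have P0 : P != 0 by rewrite eqz_nat -lt0n expn_gt0 prime_gt0 ?p_prime.
have Pgt : 0 < P by rewrite ltz_nat expn_gt0 prime_gt0 ?p_prime.
exists `|((numq q * u%:Z) %% P)%Z|%N.
  rewrite -ltz_nat gez0_abs ?modz_ge0//; exact: ltz_pmod.
set m := `|_|%N.
have mE : m%:Z = numq q * u%:Z - ((numq q * u%:Z) %/ P)%Z * P.
  by rewrite /m gez0_abs ?modz_ge0// /modz.
set w := ((numq q * u%:Z) %/ P)%Z in mE.
have eZ : u%:Z * denq q = v%:Z * P + 1.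
  by rewrite -absz_denq -!PoszM e PoszD.
have key : numq q - m%:Z * denq q = (w * denq q - numq q * v%:Z) * P.
  rewrite mE mulrBl -mulrA eZ; ring.

have dK : (denq q)%:~R != 0 :> K by rewrite -absz_denq natK_eq0 -lt0n.
have -> : z - m%:R = (z - ratr q) + ((w * denq q - numq q * v%:Z) * P)%:~R / (denq q)%:~R.
  rewrite -key rmorphB rmorphM /= mulrBl mulfK//.
  by rewrite addrA subrK.
apply: abspD_le; first exact: ltW.
rewrite rmorphM /= !abspM abspV -absz_denq /= (absp_coprime cop) invr1 mulr1.
rewrite /P -pmulrn natrX absp_pX ler_piMl ?absp_int_le1//.
Qed.

End PadicField.

(** * Fractional part and the additive character in trigonometric form *)

Lemma cosD2piz (R : realType) (x : R) (c : int) : cos (x + 2 * pi * c%:~R) = cos x.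
Proof.
have h n (y : R) : cos (y + 2 * pi * n%:R) = cos y.
  have -> : 2 * pi * n%:R = pi *+ 2 *+ n :> R by rewrite !mulr_natl mulr_natr.
  exact: periodicn (@cosD2pi R) _ _.
case: c => n; first by rewrite -pmulrn h.
rewrite NegzE rmorphN /= -[LHS](h n.+1) mulrN.
by congr cos; rewrite -pmulrn subrK.
Qed.

Lemma sinD2piz (R : realType) (x : R) (c : int) : sin (x + 2 * pi * c%:~R) = sin x.
Proof. by rewrite -2!cosBpihalf addrAC cosD2piz. Qed.

Lemma cos2pi_lt1 (R : realType) (r : R) : 0 < r < 1 -> cos (2 * pi * r) < 1.
Proof.
move=> /andP[r0 r1].
have s0 : 0 < sin (pi * r).
  by apply: sin_gt0_pi; rewrite mulr_gt0 ?pi_gt0//= gtr_pMr ?pi_gt0.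
have -> : 2 * pi * r = pi * r + pi * r by ring.
have := cos2Dsin2 (pi * r); rewrite cosD => h.
have : 0 < sin (pi * r) ^+ 2 by rewrite exprn_gt0.
by rewrite -!expr2; lra.
Qed.

Section PadicCharacter.
Variables (R : realType) (K : fieldType) (p : nat) (absp : K -> R).
Hypothesis HQp : qp_is_Qp p absp.

Local Notation fracp := (qp_fracp p absp).
Local Notation p_prime := (prime_residue_char HQp).

Lemma absp_le_pX x : exists k, absp x <= p%:R ^+ k.
Proof.
have [->|/(absp_expz HQp)[z ->]] := eqVneq x 0.
  by exists 0%N; rewrite (absp0 HQp) ler01.
exists `|z|%N; case: z => n; first by rewrite absz_nat.
rewrite NegzE -exprnN abszN absz_nat.
have h : 1 <= (p%:R : R) ^+ n.+1 by rewrite exprn_ege1// ltW ?(p_gt1 HQp).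
by rewrite (le_trans _ h)// invf_le1// (lt_le_trans ltr01).
Qed.

(** The set inside [qp_fracp] is nonempty, so [xget] does not return its default: multiply [y] by a
    power [p ^ k] that brings it into [Z_p], take the residue modulo [p ^ k] and divide back. *)
Lemma qp_fracpP y : exists m k, [/\ fracp y = m%:R / (p ^ k)%:R, (m < p ^ k)%N &
   absp (y - m%:R / (p ^ k)%:R) <= 1].
Proof.
rewrite /qp_fracp; set A := [set r : R | _].
suff /(xgetPex 0) : exists r, A r by [].
have [k hk] := absp_le_pX y.
have pk0 : 0 < (p%:R : R) ^+ k by rewrite exprn_gt0 ?(p_gt0 HQp).
have [m mk hm] : exists2 m, (m < p ^ k)%N & absp (p%:R ^+ k * y - m%:R) <= p%:R ^- k.
  apply: (exists_residue HQp) => //.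
  by rewrite (abspM HQp) (absp_pX HQp) ler_pdivrMl// mulr1.
exists (m%:R / (p ^ k)%:R), m, k; split => //.
have -> : y - m%:R / (p ^ k)%:R = (p%:R ^+ k * y - m%:R) / p%:R ^+ k.
  by rewrite natrX mulrBl mulrAC mulfV ?mul1r// expf_neq0// (pK_neq0 HQp).
rewrite (abspM HQp) (abspV HQp) (absp_pX HQp) invrK.
by rewrite (le_trans (ler_wpM2r (ltW pk0) hm))// mulVf ?gt_eqF.
Qed.

Lemma qp_fracp_ge0 y : 0 <= fracp y.
Proof. by have [m [k [-> _ _]]] := qp_fracpP y; rewrite divr_ge0. Qed.

Lemma qp_fracp_lt1 y : fracp y < 1.
Proof.
have [m [k [-> mk _]]] := qp_fracpP y.
by rewrite ltr_pdivrMr ?mul1r ?ltr_nat// ltr0n (leq_trans _ mk).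
Qed.

(** The bridge from [K] to [R]: a fraction with a [p]-power denominator that is a [p]-adic integer
    is an ordinary integer. Integrality is tested in [K] and concluded in [R]. *)
Lemma padic_integral_fraction (a : int) k : absp (a%:~R / p%:R ^+ k) <= 1 ->
  exists c : int, a%:~R / p%:R ^+ k = c%:~R :> R.
Proof.
have pk0 : 0 < (p%:R : R) ^+ k by rewrite exprn_gt0 ?(p_gt0 HQp).
rewrite (abspM HQp) (abspV HQp) (absp_pX HQp) invrK -ler_pdivlMr// mul1r => /(pX_dvd_of_absp_le HQp).
have -> : (p ^ k)%N = `|(p ^ k)%:Z|%N by [].
rewrite -dvdzE => /dvdzP[c ->]; exists c.
by rewrite rmorphM/= -pmulrn natrX mulfK ?gt_eqF.
Qed.

Lemma qp_fracp0 y : absp y <= 1 -> fracp y = 0.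
Proof.
move=> y1; have [m [k [e mk h]]] := qp_fracpP y.
have : absp ((m%:Z)%:~R / p%:R ^+ k) <= 1.
  have -> : (m%:Z)%:~R / p%:R ^+ k = y - (y - m%:R / (p ^ k)%:R).
    by rewrite opprB addrC subrK natrX.
  exact: (abspB_le HQp).
move=> /padic_integral_fraction[c]; rewrite -pmulrn -natrX -e => ec.
have := qp_fracp_ge0 y; have := qp_fracp_lt1 y; rewrite ec ler0z.
by rewrite -[1]/(1%:~R) ltr_int => h1 h2; case: c h1 h2 {ec} => // -[].
Qed.

(** The defect is a fraction with [p]-power denominator and, in [K], a combination of three
    remainders from [Z_p]; hence it is an integer. This makes the character multiplicative. *)
Lemma qp_fracpD y z : exists c : int, fracp (y + z) = fracp y + fracp z + c%:~R.
Proof.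
have [m1 [k1 [e1 _ h1]]] := qp_fracpP y.
have [m2 [k2 [e2 _ h2]]] := qp_fracpP z.
have [m3 [k3 [e3 _ h3]]] := qp_fracpP (y + z).
have pn0 k : (p%:R : K) ^+ k != 0 by rewrite expf_neq0// (pK_neq0 HQp).
have pR0 k : (p%:R : R) ^+ k != 0 by rewrite expf_neq0// (p_neq0 HQp).
pose a : int := (m3 * p ^ k1 * p ^ k2)%:Z - (m1 * p ^ k2 * p ^ k3)%:Z - (m2 * p ^ k1 * p ^ k3)%:Z.
(* Stated over any field where [p] is invertible, since the same identity is needed in [K] for the
   bound and in [R] for the conclusion. *)
have aE (F : fieldType) : (forall k, (p%:R : F) ^+ k != 0) ->
    a%:~R / p%:R ^+ (k1 + k2 + k3) =
    m3%:R / (p ^ k3)%:R - m1%:R / (p ^ k1)%:R - m2%:R / (p ^ k2)%:R :> F.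
  move=> pF; rewrite /a !rmorphB /= -!pmulrn !natrM !natrX !exprD.
  by field; rewrite !pF.
have [] := @padic_integral_fraction a (k1 + k2 + k3).
  rewrite aE//.
  have -> : m3%:R / (p ^ k3)%:R - m1%:R / (p ^ k1)%:R - m2%:R / (p ^ k2)%:R =
     (y - m1%:R / (p ^ k1)%:R) + (z - m2%:R / (p ^ k2)%:R) - (y + z - m3%:R / (p ^ k3)%:R).
    by ring.
  by apply: (abspB_le HQp) => //; exact: (abspD_le HQp).
move=> c; rewrite aE// -e1 -e2 -e3 => ec; exists c; rewrite -ec; ring.
Qed.

Let theta (y : K) : R := 2 * pi * fracp y.

Lemma cos_fracpD y z : cos (theta (y + z)) =
  cos (theta y) * cos (theta z) - sin (theta y) * sin (theta z).
Proof.
have [c e] := qp_fracpD y z.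
by rewrite -cosD /theta e mulrDr cosD2piz mulrDr.
Qed.

Lemma sin_fracpD y z : sin (theta (y + z)) =
  sin (theta y) * cos (theta z) + cos (theta y) * sin (theta z).
Proof.
have [c e] := qp_fracpD y z.
by rewrite -sinD /theta e mulrDr sinD2piz mulrDr.
Qed.

(** Nontriviality of the character: [p^-1] is not in [Z_p], so its fractional part lies strictly
    between 0 and 1. *)
Lemma cos_fracp_pV : cos (theta p%:R^-1) != 1.
Proof.
rewrite lt_eqF// cos2pi_lt1// qp_fracp_lt1 lt_def qp_fracp_ge0 !andbT.
apply/eqP => f0; have [m [k [e mk]]] := qp_fracpP p%:R^-1.
move: e; rewrite f0 => /esym/eqP.
rewrite mulf_eq0 invr_eq0 !pnatr_eq0 (gtn_eqF (leq_ltn_trans _ mk))// orbF => /eqP ->.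
by rewrite mul0r subr0 (abspV HQp) (absp_p HQp) invrK leNgt (p_gt1 HQp).
Qed.

End PadicCharacter.

(** * The max norm on [Q_p^N] and the subdivision of balls *)

Section PadicVectors.
Variables (R : realType) (K : fieldType) (p : nat) (absp : K -> R) (N : nat).
Hypothesis HQp : qp_is_Qp p absp.

Local Notation V := (qp_QpN R K absp N).
Local Notation normp := (@qp_normp R K absp N).
Local Notation vsub := (@qp_vsub K N).

Lemma normp_ge0 x : 0 <= normp x.
Proof. by apply: (big_ind (fun r => 0 <= r)) => [|r s r0 _|i _]; rewrite ?le_max ?r0 ?(absp_ge0 HQp). Qed.

Lemma normp_le (x : V) r : 0 <= r -> (normp x <= r) <-> (forall i, absp (x i) <= r).
Proof.
move=> r0; split => [h i|h]; first exact: le_trans (le_bigmax _ _ i) h.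
exact: bigmax_le.
Qed.

Lemma normp0 : normp (@qp_vzero R K absp N) = 0.
Proof.
apply/eqP; rewrite eq_le normp_ge0 andbT.
by apply/normp_le => // i; rewrite /qp_vzero (absp0 HQp).
Qed.

Lemma normp_argmax (x : V) : x <> @qp_vzero R K absp N ->
  exists2 i, x i != 0 & normp x = absp (x i).
Proof.
move=> x0; have [j xj] : exists j, x j != 0.
  apply/not_existsP => h; apply: x0; apply/funext => i; apply/eqP.
  by apply/negP => /negP/(h i).
pose i := [arg max_(i > j) absp (x i)]%O.
have im k : absp (x k) <= absp (x i).
  by rewrite /i; case: (@Order.TotalTheory.arg_maxP _ _ _ j xpredT) => // i' _; apply.
exists i; first by rewrite -(absp_gt0 HQp) (lt_le_trans _ (im j))// (absp_gt0 HQp).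
apply/eqP; rewrite eq_le le_bigmax andbT.
by apply/normp_le => //; exact: (absp_ge0 HQp).
Qed.

Lemma normp_expz (x : V) : x <> @qp_vzero R K absp N -> exists z : int, normp x = p%:R ^ z.
Proof. by move=> /normp_argmax[i xi ->]; exact: (absp_expz HQp). Qed.

Lemma normp_gt0 (x : V) : x <> @qp_vzero R K absp N -> 0 < normp x.
Proof. by move=> /normp_argmax[i xi ->]; rewrite (absp_gt0 HQp). Qed.

Lemma normp_vsubC (x y : V) : normp (vsub x y) = normp (vsub y x).
Proof. by apply: eq_bigr => i _; rewrite /qp_vsub (abspB HQp). Qed.

Lemma normp_vsub0 (x : V) : normp (vsub x (@qp_vzero R K absp N)) = normp x.
Proof. by apply: eq_bigr => i _; rewrite /qp_vsub /qp_vzero subr0. Qed.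

Lemma normp_vsub_trans (x y z : V) r :
  normp (vsub x y) <= r -> normp (vsub y z) <= r -> normp (vsub x z) <= r.
Proof.
move=> hx hy; have r0 : 0 <= r := le_trans (normp_ge0 _) hx.
move/(normp_le _ r0) : hx => hx; move/(normp_le _ r0) : hy => hy.
apply/normp_le => // i; rewrite /qp_vsub.
have -> : x i - z i = (x i - y i) + (y i - z i) by rewrite addrA subrK.
exact: (abspD_le HQp (hx i) (hy i)).
Qed.

Definition qp_ball (a : V) (r : R) : set V := [set x | normp (vsub x a) <= r].

Lemma qp_ball_open a r : 0 < r -> @qp_openp R K absp N (qp_ball a r).
Proof.
move=> r0 x xa; exists r => // y yx.
by apply: normp_vsub_trans xa; exact: ltW.
Qed.

Lemma qp_open_measurable (U : set V) : qp_openp absp U -> measurable U.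
Proof. exact: sub_sigma_algebra. Qed.

Lemma qp_ball_measurable a r : 0 < r -> measurable (qp_ball a r).
Proof. by move=> r0; apply: qp_open_measurable; exact: qp_ball_open. Qed.

Lemma qp_ball0E r : qp_ball (@qp_vzero R K absp N) r = [set x | normp x <= r].
Proof. by apply/seteqP; split => x /=; rewrite /qp_ball /= normp_vsub0. Qed.

(** Representatives of the cosets of [c p Z_p^N] in [a + c Z_p^N], one for each vector [r] of
    [p]-adic digits. *)
Definition qp_subcenter (a : V) (c : K) (r : {ffun 'I_N -> 'I_p}) : V :=
  fun i => a i + c * (r i : nat)%:R.

(** After translation by [a] and division by [c], this is reduction modulo [p] in each coordinate.
    The [p ^ N] pieces serve both compactness and the computation of Haar measure. *)
Lemma qp_ball_split a c : c != 0 ->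
  qp_ball a (absp c) = \bigcup_r qp_ball (qp_subcenter a c r) (absp (c * p%:R)).
Proof.
move=> c0; have c1 : 0 < absp c by rewrite (absp_gt0 HQp).
have cp0 := absp_ge0 HQp (c * p%:R).
apply/seteqP; split => x.
  move=> /(normp_le _ (ltW c1)) h.
  have res i : exists m : 'I_p, absp ((x i - a i) / c - (m : nat)%:R) <= p%:R^-1.
    have [|m mp hm] := @exists_residue R K p absp HQp 1 ((x i - a i) / c).
      by rewrite (abspM HQp) (abspV HQp) ler_pdivrMr// mul1r; exact: h.
    rewrite expn1 in mp; rewrite expr1 in hm.
    by exists (Ordinal mp).
  have [m hm] := choice res.
  exists [ffun i => m i] => //; apply/normp_le => // i.
  rewrite /qp_vsub /qp_subcenter ffunE.
  have -> : x i - (a i + c * (m i : nat)%:R) = c * ((x i - a i) / c - (m i : nat)%:R).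
    by field.
  by rewrite !(abspM HQp) (absp_p HQp) ler_wpM2l// ltW.
move=> [r _] /(normp_le _ cp0) h; apply/normp_le => [|i]; first exact: ltW.
have -> : vsub x a i = vsub x (qp_subcenter a c r) i + c * (r i : nat)%:R.
  by rewrite /qp_vsub /qp_subcenter; ring.
apply: (abspD_le HQp).
  rewrite (le_trans (h i))// (abspM HQp) (absp_p HQp) ler_piMr ?ltW//.
  by rewrite invf_lt1 ?(p_gt0 HQp) ?(p_gt1 HQp).
by rewrite (abspM HQp) ler_piMr ?(absp_nat_le1 HQp)// ltW.
Qed.

(** A common point would put the two centres within [absp (c * p)] of each other, so [p] would
    divide a difference of two distinct digits below [p]. *)
Lemma qp_ball_split_trivIset a c : c != 0 ->
  trivIset setT (fun r => qp_ball (qp_subcenter a c r) (absp (c * p%:R))).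
Proof.
move=> c0; have cp0 := absp_ge0 HQp (c * p%:R).
apply/trivIsetP => r s _ _ rs; apply/seteqP; split => // x [/= hr hs].
have [i ri] : exists i, r i <> s i.
  apply/not_existsP => h; move/eqP: rs; apply; apply/ffunP => i.
  by apply: contrapT; exact: h.
have : normp (vsub (qp_subcenter a c r) (qp_subcenter a c s)) <= absp (c * p%:R).
  by apply: normp_vsub_trans hs; rewrite normp_vsubC.
move=> /(normp_le _ cp0)/(_ i); rewrite /qp_vsub /qp_subcenter.
have -> : a i + c * (r i : nat)%:R - (a i + c * (s i : nat)%:R) =
   c * (((r i : nat)%:Z - (s i : nat)%:Z)%:~R).
  by rewrite rmorphB /= -!pmulrn; ring.
rewrite !(abspM HQp) ler_pM2l ?(absp_gt0 HQp)// (absp_p HQp) -[p%:R]expr1.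
move=> /(pX_dvd_of_absp_le HQp); rewrite expn1.
move=> /dvdn_leq; have := ltn_ord (r i); have := ltn_ord (s i).
have : (r i : nat) <> s i by move=> /val_inj.
move: (r i : nat) (s i : nat) => u v uv hv hu h.
have := h _; lia.
Qed.

End PadicVectors.

(** * Compactness of balls *)

Section PadicBalls.
Variables (R : realType) (K : fieldType) (p : nat) (absp : K -> R) (N : nat).
Hypothesis HQp : qp_is_Qp p absp.

Local Notation V := (qp_QpN R K absp N).
Local Notation normp := (@qp_normp R K absp N).
Local Notation vsub := (@qp_vsub K N).
Local Notation ball := (@qp_ball R K absp N).

Let covered (F : set (set V)) (A : set V) :=
  exists2 G : set (set V), finite_set G /\ G `<=` F & A `<=` \bigcup_(U in G) U.

Let covered_bigcup (I : finType) F (A : I -> set V) :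
  (forall i, covered F (A i)) -> covered F (\bigcup_i A i).
Proof.
move=> h.
have /choice[G GP] i : exists G : set (set V), [/\ finite_set G, G `<=` F & A i `<=` \bigcup_(U in G) U].
  by case: (h i) => G [fG GF] AG; exists G.
exists (\bigcup_i G i); first split.
- by apply: bigcup_finite => // i _; case: (GP i).
- by move=> U [i _]; case: (GP i) => _ GF _ /GF.
- move=> x [i _ Ax]; have [_ _ /(_ x Ax) [U GU Ux]] := GP i.
  by exists U => //; exists i.
Qed.

Lemma absp_mul_pX_small c (e : R) : 0 < e -> exists n, forall m, (n <= m)%N -> absp (c * p%:R ^+ m) < e.
Proof.
move=> e0; exists (Num.bound (absp c / e)) => m nm.
have : absp c / e < 2 ^+ m by exact: upper_nthrootP.
rewrite ltr_pdivrMr// => h.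
rewrite (abspM HQp) (absp_pX HQp) ltr_pdivrMr ?exprn_gt0 ?(p_gt0 HQp)//.
rewrite (lt_le_trans h)// mulrC ler_pM2l//.
by rewrite lerXn2r ?nnegrE// ler_nat prime_gt1// (prime_residue_char HQp).
Qed.

(** Successive errors do not add up: by the ultrametric inequality the first one bounds the
    total. *)
Let chain_dist c (u : nat -> V) :
  (forall n, ball (u n) (absp (c * p%:R ^+ n)) (u n.+1)) ->
  forall n m, (n <= m)%N -> ball (u n) (absp (c * p%:R ^+ n)) (u m).
Proof.
move=> hu n m /subnK <-; elim: (m - n)%N => [|k IH].
  rewrite add0n /qp_ball /=; apply/normp_le => [|i]; first exact: absp_ge0 HQp _.
  by rewrite /qp_vsub subrr (absp0 HQp) (absp_ge0 HQp).
rewrite addSn; apply: (normp_vsub_trans HQp) _ IH.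
apply: (@le_trans _ _ (absp (c * p%:R ^+ (k + n)))); first exact: hu.
rewrite exprD mulrCA (abspM HQp (p%:R ^+ k)) ler_piMl ?(absp_ge0 HQp)//.
by rewrite -natrX (absp_nat_le1 HQp).
Qed.

Let chain_limit c (u : nat -> V) : c != 0 ->
  (forall n, ball (u n) (absp (c * p%:R ^+ n)) (u n.+1)) ->
  exists l : V, forall n, ball (u n) (absp (c * p%:R ^+ n)) l.
Proof.
move=> c0 /chain_dist hu.
have coord n m i : (n <= m)%N -> absp (u m i - u n i) <= absp (c * p%:R ^+ n).
  by move=> /hu/(normp_le _ (absp_ge0 HQp _))/(_ i).
have /choice[l hl] i : exists l, forall e : R, 0 < e -> exists n, forall m, (n <= m)%N ->
    absp (u m i - l) < e.
  apply: (absp_complete HQp) => e e0; have [n hn] := absp_mul_pX_small c e0.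
  exists n => m k nm nk; apply: le_lt_trans (hn n (leqnn n)).
  have -> : u m i - u k i = (u m i - u n i) - (u k i - u n i) by ring.
  by apply: (abspB_le HQp); exact: coord.
exists l => n; apply/normp_le => [|i]; first exact: absp_ge0 HQp _.
have cn0 : 0 < absp (c * p%:R ^+ n).
  by rewrite (absp_gt0 HQp) mulf_neq0// expf_neq0// (pK_neq0 HQp).
have [m hm] := hl i _ cn0.
have -> : vsub l (u n) i = (u (maxn m n) i - u n i) - (u (maxn m n) i - l i).
  by rewrite /qp_vsub; ring.
by apply: (abspB_le HQp); [exact/coord/leq_maxr|exact/ltW/hm/leq_maxl].
Qed.

(** Heine-Borel by subdivision: a ball without finite subcover has a piece without finite subcover,
    and completeness gives a point common to the nested pieces. One open set of the cover contains
    that point, hence an entire small piece, a contradiction. *)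
Lemma qp_ball_compact c : c != 0 -> @qp_compactp R K absp N (ball (@qp_vzero R K absp N) (absp c)).
Proof.
move=> c0 F Fo Fc; apply: contrapT => nc.
have cn n : c * p%:R ^+ n != 0 by rewrite mulf_neq0// expf_neq0// (pK_neq0 HQp).
pose Q n a := ~ covered F (ball a (absp (c * p%:R ^+ n))).
(* Phrased as an implication, so that every pair has a successor and [choice] returns a total
   function. *)
have step (na : nat * V) : exists b, Q na.1 na.2 -> Q na.1.+1 b /\ ball na.2 (absp (c * p%:R ^+ na.1)) b.
  case: na => n a /=; have [Qa|nQ] := pselect (Q n a); last by exists a.
  apply: contrapT => /forallNP h; apply: Qa.
  rewrite (qp_ball_split HQp)//; apply: covered_bigcup => r.
  apply: contrapT => Qr; apply: (h (qp_subcenter a (c * p%:R ^+ n) r)) => _; split.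
    by rewrite /Q exprSr mulrA.
  apply/normp_le => [|i]; first exact: absp_ge0 HQp _.
  rewrite /qp_vsub /qp_subcenter addrC addKr (abspM HQp).
  by rewrite ler_piMr ?(absp_ge0 HQp)// (absp_nat_le1 HQp).
have [g hg] := choice step.
pose u := fix u n := if n is n'.+1 then g (n', u n') else @qp_vzero R K absp N.
have Qu n : Q n (u n).
  elim: n => [|n /(hg (n, u n))[]//]; by rewrite /Q expr0 mulr1.
have [|l hl] := @chain_limit c u c0; first by move=> n; have [] := hg (n, u n) (Qu n).
have [|U FU Ul] := Fc l; first by have := hl 0%N; rewrite expr0 mulr1.
have [e e0 hU] := Fo U FU l Ul.
have [n hn] := absp_mul_pX_small c e0.
apply: (Qu n); exists [set U].
  by split; [exact: finite_set1|move=> _ ->].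
move=> x xu; exists U => //; apply: hU; apply: le_lt_trans (hn n (leqnn n)).
apply: (normp_vsub_trans HQp) xu _; rewrite (normp_vsubC HQp).
exact: hl.
Qed.

End PadicBalls.

(** * Haar measure of balls and translation invariance of integrals *)

Section HaarMeasure.
Variables (R : realType) (K : fieldType) (p : nat) (absp : K -> R) (N : nat).
Hypothesis HQp : qp_is_Qp p absp.

Local Notation V := (qp_QpN R K absp N).
Local Notation normp := (@qp_normp R K absp N).
Local Notation vsub := (@qp_vsub K N).
Local Notation vadd := (@qp_vadd K N).
Local Notation ball := (@qp_ball R K absp N).
Local Notation v0 := (@qp_vzero R K absp N).

Lemma locally_constant_measurable (g : V -> R) :
  (forall x, exists2 e : R, 0 < e & forall y, normp (vsub y x) < e -> g y = g x) ->
  measurable_fun setT g.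
Proof.
move=> hg _ Y _; rewrite setTI; apply: qp_open_measurable => x Yx.
by have [e e0 he] := hg x; exists e => // y /he; rewrite /preimage /= => ->.
Qed.

Lemma translation_measurable (a : V) : measurable_fun setT (fun x : V => vadd x a : V).
Proof.
apply: (@measurability _ _ V V setT _ (@qp_openp R K absp N)) => // _ [U oU <-].
rewrite setTI; apply: qp_open_measurable => x /oU[e e0 he]; exists e => // y yx.
apply: he; move: yx; congr (_ < _); apply: eq_bigr => i _.
by rewrite /qp_vsub /qp_vadd opprD addrACA subrr addr0.
Qed.

Variable lam : {measure set V -> \bar R}.
Hypothesis Hlam : qp_haar_measure lam.

Lemma haar_translation (A : set V) (a : V) : measurable A ->
  lam [set x : V | A (vadd x a)] = lam A.
Proof.
move=> mA; case: Hlam => _ /(_ A (qp_vopp a) mA) <- _.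
congr (lam _); apply/seteqP; split => x.
  move=> Ax; exists (vadd x a) => //; apply/funext => i.
  by rewrite /qp_vadd /qp_vopp addrK.
move=> [y Ay <-] /=.
suff -> : vadd (vadd y (qp_vopp a)) a = y by [].
by apply/funext => i; rewrite /qp_vadd /qp_vopp subrK.
Qed.

Lemma haar_ball_center (a : V) r : 0 < r -> lam (ball a r) = lam (ball v0 r).
Proof.
move=> r0; rewrite -(haar_translation a (qp_ball_measurable HQp a r0)).
congr (lam _); apply/funext => x; rewrite /qp_ball /=.
suff -> : vsub (vadd x a) a = vsub x v0 by [].
by apply/funext => i; rewrite /qp_vsub /qp_vadd /qp_vzero addrK subr0.
Qed.

(** The ball is a disjoint union of [p ^ N] translates of the smaller one. *)
Lemma haar_ball_mul_p c : c != 0 ->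
  lam (ball v0 (absp c)) = ((p ^ N)%:R%:E * lam (ball v0 (absp (c * p%:R))))%E.
Proof.
move=> c0; have cp0 : 0 < absp (c * p%:R) by rewrite (absp_gt0 HQp) mulf_neq0// (pK_neq0 HQp).
rewrite (qp_ball_split HQp v0 c0) -fsbig_setU; last exact: finite_finset.
rewrite measure_fsbig; last 3 first.
- exact: finite_finset.
- by move=> r _; exact: (qp_ball_measurable HQp).
- exact: (qp_ball_split_trivIset HQp).
under eq_fsbigr do rewrite haar_ball_center//.
have -> : [set: {ffun 'I_N -> 'I_p}] = [set` index_enum {ffun 'I_N -> 'I_p}].
  by apply/seteqP; split => // r _; rewrite /= mem_index_enum.
rewrite -fsbig_seq ?index_enum_uniq// sumr_const card_ffun !card_ord.
by rewrite mule_natl.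
Qed.

Lemma haar_ball_pX n : lam (ball v0 (p%:R ^- n)) = (p%:R ^- (n * N))%:E.
Proof.
elim: n => [|n IH].
  by case: Hlam => _ _ h; rewrite mul0n expr0 invr1 qp_ball0E.
have pn0 : p%:R ^+ n != 0 :> K by rewrite expf_neq0// (pK_neq0 HQp).
move: IH; rewrite -!(absp_pX HQp) (haar_ball_mul_p pn0) exprSr.
have pN0 : (p ^ N)%:R != 0 :> R by rewrite natrX expf_neq0// (p_neq0 HQp).
have : 0 < (p ^ N)%:R :> R by rewrite lt_def pN0/=.
(* An infinite measure of the smaller ball would contradict the finite measure of the larger one; in
   the finite case [p ^ N] is cancelled. *)
case: (lam _) => [r| |] // pN.
- rewrite -EFinM => -[e]; congr EFin; apply: (mulfI pN0); rewrite e.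
  rewrite !(absp_pX HQp) mulSn exprD invfM mulrA natrX mulfV ?mul1r//.
  by rewrite expf_neq0// (p_neq0 HQp).
- by rewrite mulry gtr0_sg// mul1e.
- by rewrite mulrNy gtr0_sg// mul1e.
Qed.

(** Change of variables: the image of [lam] under translation by [a] is [lam], and [B] is its own
    preimage. *)
Lemma haar_integral_translation (g : V -> R) (a : V) (B : set V) : measurable B ->
  measurable_fun setT g -> lam.-integrable B (fun x => (g (vadd x a))%:E) ->
  (forall x, B (vadd x a) <-> B x) ->
  \int[lam]_(x in B) g (vadd x a) = \int[lam]_(x in B) g x.
Proof.
move=> mB mg ig hB; rewrite /Rintegral; congr fine.
have pB : (fun x : V => vadd x a : V) @^-1` B = B.
  by apply/seteqP; split => x /hB.
have := @integral_pushforward _ _ V V R _ (translation_measurable a) lam B (EFin \o g).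
rewrite pB => <- //; last exact/measurable_EFinP.
apply: eq_measure_integral => [|mt A mA _]; first exact: translation_measurable.
exact: haar_translation.
Qed.

End HaarMeasure.

(** * Fourier transform of the indicator of a ball *)

Section FourierBall.
Variables (R : realType) (K : fieldType) (p : nat) (absp : K -> R) (N : nat).
Hypothesis HQp : qp_is_Qp p absp.

Local Notation V := (qp_QpN R K absp N).
Local Notation normp := (@qp_normp R K absp N).
Local Notation vsub := (@qp_vsub K N).
Local Notation vadd := (@qp_vadd K N).
Local Notation ball := (@qp_ball R K absp N).
Local Notation v0 := (@qp_vzero R K absp N).
Local Notation dot := (@qp_vdot K N).

Lemma absp_vdot_le (xi x : V) r s : normp xi <= r -> normp x <= s -> absp (dot xi x) <= r * s.
Proof.
move=> hr hs; have r0 := le_trans (normp_ge0 HQp _) hr; have s0 := le_trans (normp_ge0 HQp _) hs.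
move/(normp_le _ r0) : hr => hr; move/(normp_le _ s0) : hs => hs.
rewrite /qp_vdot; apply: (big_ind (fun z => absp z <= r * s)).
- by rewrite (absp0 HQp) mulr_ge0.
- by move=> y z; exact: (abspD_le HQp).
- by move=> i _; rewrite (abspM HQp) ler_pM ?(absp_ge0 HQp).
Qed.

Lemma vdotDr (xi x y : V) : dot xi (vadd x y) = dot xi x + dot xi y.
Proof. by rewrite /qp_vdot -big_split; apply: eq_bigr => i _; rewrite /qp_vadd mulrDr. Qed.

Let C (xi x : V) := cos (2 * pi * qp_fracp p absp (- dot xi x)).
Let S (xi x : V) := sin (2 * pi * qp_fracp p absp (- dot xi x)).

Let CD xi x a : C xi (vadd x a) = C xi x * C xi a - S xi x * S xi a.
Proof. by rewrite /C /S vdotDr opprD (cos_fracpD HQp). Qed.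

Let SD xi x a : S xi (vadd x a) = S xi x * C xi a + C xi x * S xi a.
Proof. by rewrite /C /S vdotDr opprD (sin_fracpD HQp). Qed.

Let C1 xi x : absp (dot xi x) <= 1 -> C xi x = 1.
Proof. by move=> h; rewrite /C (qp_fracp0 HQp) ?(abspN HQp)// mulr0 cos0. Qed.

Let S0 xi x : absp (dot xi x) <= 1 -> S xi x = 0.
Proof. by move=> h; rewrite /S (qp_fracp0 HQp) ?(abspN HQp)// mulr0 sin0. Qed.

Lemma normp_le_pX (x : V) : exists k, normp x <= p%:R ^+ k.
Proof.
have [x0|x0] := pselect (x = v0); first by exists 0%N; rewrite x0 (normp0 _ HQp) ler01.
by have [i _ ->] := normp_argmax HQp x0; exact: (absp_le_pX HQp).
Qed.

(** On this neighbourhood the increment of [dot xi] stays in [Z_p], where the character is 1; so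
    [C xi] and [S xi] are locally constant, hence measurable. *)
Let near_dot (xi x : V) : exists2 e : R, 0 < e & forall y, normp (vsub y x) < e ->
  absp (dot xi (vsub y x)) <= 1.
Proof.
have [k hk] := normp_le_pX xi; have pk : 0 < (p%:R : R) ^+ k by rewrite exprn_gt0 ?(p_gt0 HQp).
exists (p%:R ^- k); first by rewrite invr_gt0.
by move=> y /ltW yx; rewrite (le_trans (absp_vdot_le hk yx))// mulfV ?gt_eqF.
Qed.

Let vaddK (x y : V) : vadd x (vsub y x) = y.
Proof. by apply/funext => i; rewrite /qp_vadd /qp_vsub addrC subrK. Qed.

Let C_meas xi : measurable_fun setT (C xi : V -> R).
Proof.
apply: locally_constant_measurable => x; have [e e0 he] := near_dot xi x.
exists e => // y /he h; rewrite -[in LHS](vaddK x y) CD.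
by rewrite (C1 h) (S0 h) mulr1 mulr0 subr0.
Qed.

Let S_meas xi : measurable_fun setT (S xi : V -> R).
Proof.
apply: locally_constant_measurable => x; have [e e0 he] := near_dot xi x.
exists e => // y /he h; rewrite -[in LHS](vaddK x y) SD.
by rewrite (C1 h) (S0 h) mulr1 mulr0 addr0.
Qed.

Variable lam : {measure set V -> \bar R}.
Hypothesis Hlam : qp_haar_measure lam.

Let B n := ball v0 (p%:R ^- n).

Let pXn_gt0 n : 0 < (p%:R : R) ^- n.
Proof. by rewrite invr_gt0 exprn_gt0 ?(p_gt0 HQp). Qed.

Let mB n : measurable (B n).
Proof. exact: (qp_ball_measurable HQp). Qed.

Let bounded_integrable n (g : V -> R) : measurable_fun setT g ->
  (forall x, `|g x| <= 1) -> lam.-integrable (B n) (EFin \o g).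
Proof.
move=> mg g1; apply: measurable_bounded_integrable => //.
- by rewrite [X in (X < _)%E](haar_ball_pX HQp Hlam) ltry.
- exact: measurable_funTS.
- by exists 1; split => // M M1 x _; exact: le_trans (g1 x) (ltW M1).
Qed.

Let C_int n xi : lam.-integrable (B n) (EFin \o C xi).
Proof. by apply: bounded_integrable => // x; rewrite ler_norml cos_geN1 cos_le1. Qed.

Let S_int n xi : lam.-integrable (B n) (EFin \o S xi).
Proof. by apply: bounded_integrable => // x; rewrite ler_norml sin_geN1 sin_le1. Qed.

Let B_translate n a x : B n a -> B n (vadd x a) <-> B n x.
Proof.
rewrite /B qp_ball0E /= => ha.
have hN : normp (qp_vopp a) <= p%:R ^- n.
  move/(normp_le _ (ltW (pXn_gt0 n))) : ha => ha.
  by apply/normp_le => [|i]; [exact: ltW|rewrite /qp_vopp (abspN HQp)].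
have add (y z : V) : normp y <= p%:R ^- n -> normp z <= p%:R ^- n -> normp (vadd y z) <= p%:R ^- n.
  move=> /(normp_le _ (ltW (pXn_gt0 n))) hy /(normp_le _ (ltW (pXn_gt0 n))) hz.
  by apply/normp_le => [|i]; [exact: ltW|exact: (abspD_le HQp)].
split => h; last exact: add.
have -> : x = vadd (vadd x a) (qp_vopp a).
  by apply/funext => i; rewrite /qp_vadd /qp_vopp addrK.
exact: add.
Qed.

(* Translating by [a] in the ball rotates the vector (int C, int S) by the angle of [a]. *)
Let rotate n xi a : B n a ->
  \int[lam]_(x in B n) C xi x =
    (\int[lam]_(x in B n) C xi x) * C xi a - (\int[lam]_(x in B n) S xi x) * S xi a /\
  \int[lam]_(x in B n) S xi x =
    (\int[lam]_(x in B n) S xi x) * C xi a + (\int[lam]_(x in B n) C xi x) * S xi a.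
Proof.
move=> Ba.
have tr (g : V -> R) : measurable_fun setT g -> (forall x, `|g x| <= 1) ->
    \int[lam]_(x in B n) g (vadd x a) = \int[lam]_(x in B n) g x.
  move=> mg g1; apply: (haar_integral_translation Hlam) => //.
    apply: (@bounded_integrable n (fun x => g (vadd x a))) => //.
    by apply: (measurableT_comp mg); exact: translation_measurable.
  by move=> x; exact: B_translate.
have intM (g : V -> R) (c : R) : lam.-integrable (B n) (EFin \o g) ->
    lam.-integrable (B n) (EFin \o (fun x => g x * c)).
  by move=> ig; have := integrableZr (mB n) c ig; apply: eq_integrable.
split.
- rewrite -[LHS]tr//; last by move=> x; rewrite ler_norml cos_geN1 cos_le1.
  under eq_Rintegral do rewrite CD.
  rewrite RintegralB ?RintegralZr//; exact: intM.
- rewrite -[LHS]tr//; last by move=> x; rewrite ler_norml sin_geN1 sin_le1.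
  under eq_Rintegral do rewrite SD.
  rewrite RintegralD ?RintegralZr//; exact: intM.
Qed.

Let exists_nontrivial n xi : ~ (normp xi <= p%:R ^+ n) -> exists2 a, B n a & C xi a != 1.
Proof.
move=> hxi; have xi0 : xi <> v0.
  by move=> h; apply: hxi; rewrite h (normp0 _ HQp) exprn_ge0.
have [i xii e] := normp_argmax HQp xi0.
have [z ez] := absp_expz HQp xii.
have nz : (n%:Z < z)%R.
  move/negP : hxi; rewrite -ltNge e ez exprnP ltr_eXz2l//; exact: (p_gt1 HQp).
(* Supported on the coordinate where [xi] attains its norm and chosen so that [- dot xi a = p^-1].
   Its norm is [p ^ (1 - z)], at most [p ^ -n] exactly because [n < z]. *)
pose a : V := fun j => if j == i then - (p%:R * xi i)^-1 else 0.
exists a.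
  rewrite /B qp_ball0E /=; apply/normp_le => [|j]; first exact: ltW.
  rewrite /a; case: eqP => _; last by rewrite (absp0 HQp) ltW.
  rewrite (abspN HQp) (abspV HQp) (abspM HQp) (absp_p HQp) ez.
  rewrite lef_pV2 ?posrE ?exprn_gt0 ?mulr_gt0 ?invr_gt0 ?exprz_gt0 ?(p_gt0 HQp)//.
  rewrite ler_pdivlMl ?(p_gt0 HQp)// -exprS exprnP ler_eXz2l ?(p_gt1 HQp)//.
have -> : C xi a = cos (2 * pi * qp_fracp p absp p%:R^-1).
  rewrite /C; congr (cos (_ * qp_fracp _ _ _)).
  rewrite /qp_vdot (bigD1 i)//= big1 ?addr0.
    rewrite /a eqxx mulrN opprK invfM mulrCA mulfV ?mulr1//.
  by move=> j ji; rewrite /a (negPf ji) mulr0.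
exact: (cos_fracp_pV HQp).
Qed.

(** For [xi] in the dual ball the character is 1 on [B n]. Otherwise the vector of the two integrals
    is fixed by a nontrivial rotation, so it vanishes. *)
Let integrals n xi :
  \int[lam]_(x in B n) C xi x = p%:R ^- (n * N) * \1_(ball v0 (p%:R ^+ n)) xi /\
  \int[lam]_(x in B n) S xi x = 0.
Proof.
have [h|h] := pselect (normp xi <= p%:R ^+ n).
  rewrite indicE mem_set; last by rewrite qp_ball0E.
  have dn x : x \in B n -> absp (dot xi x) <= 1.
    rewrite inE /B qp_ball0E /= => hx.
    by rewrite (le_trans (absp_vdot_le h hx))// mulfV// expf_neq0// (p_neq0 HQp).
  have -> : \int[lam]_(x in B n) C xi x = \int[lam]_(x in B n) 1 by apply: eq_Rintegral => x /dn; exact: C1.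
  have -> : \int[lam]_(x in B n) S xi x = \int[lam]_(x in B n) 0 by apply: eq_Rintegral => x /dn; exact: S0.
  rewrite !Rintegral_cst//= mul0r mul1r mulr1; split => //.
  by rewrite [X in fine X](haar_ball_pX HQp Hlam).
have [a Ba Ca] := exists_nontrivial h.
have [] := rotate xi Ba; move: (Rintegral _ _ _) (Rintegral _ _ _) => I J e1 e2.
rewrite indicE memNset; last by rewrite qp_ball0E.
rewrite mulr0.
have cs : C xi a ^+ 2 + S xi a ^+ 2 = 1 by exact: cos2Dsin2.
(* This is the determinant [(C - 1)^2 + S^2] of the rotation minus the identity. *)
have d0 : 2 - 2 * C xi a != 0.
  by apply: contra_neq Ca => h0; lra.
split; apply: (mulIf d0); rewrite mul0r; move: e1 e2 cs; nra.
Qed.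

Lemma qp_fourier_ball n (xi : V) :
  qp_fourier p lam (fun x => (\1_(ball v0 (p%:R ^- n)) x)%:C%C) xi =
  (p%:R ^- (n * N) * \1_(ball v0 (p%:R ^+ n)) xi)%:C%C.
Proof.
have [hC hS] := integrals n xi.
rewrite /qp_fourier /qp_Cint; congr Complex.
- rewrite -hC [RHS]Rintegral_mkcond; apply: eq_Rintegral => x _.
  rewrite patchE /C /= mulr0 subr0 indicE /B.
  by case: ifP => _; rewrite ?mulr1 ?mulr0.
- rewrite -[RHS]hS [RHS]Rintegral_mkcond; apply: eq_Rintegral => x _.
  rewrite patchE /S /= mulr0 add0r indicE /B.
  by case: ifP => _; rewrite ?mulr1 ?mulr0.
Qed.

End FourierBall.

(** * Geometric series in the extended reals and scaling of integrals *)

Section Series.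
Variable R : realType.

Lemma eseries_EFin_cvg (u : nat -> R) k l :
  (\sum_(0 <= i < n + k) u i)%R @[n --> \oo] --> l ->
  (\sum_(0 <= n <oo) (u n)%:E = l%:E)%E.
Proof.
move=> ul; apply/cvg_lim => //.
rewrite [X in X @ _](_ : _ = (fun n => (\sum_(0 <= i < n) u i)%:E)); last first.
  by apply/funext => n; rewrite sumEFin.
apply: cvg_EFin; first by near=> n.
by rewrite -(cvg_shiftn k).
Unshelve. all: end_near. Qed.

Lemma eseries_geometric_tail (s : R) m : 0 <= s < 1 ->
  (\sum_(0 <= n <oo) ((1 - s) * s ^+ n * (m <= n)%N%:R)%:E = (s ^+ m)%:E)%E.
Proof.
move=> /andP[s0 s1]; apply: (@eseries_EFin_cvg _ m).
(* The telescoped partial sum; the [maxn] also covers [n < m], where the sum is still 0. *)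
have E n : \sum_(0 <= i < n) (1 - s) * s ^+ i * (m <= i)%N%:R = s ^+ m - s ^+ maxn m n.
  elim: n => [|n IH]; first by rewrite big_nil maxn0 subrr.
  rewrite big_nat_recr//= IH; case: (leqP m n) => mn.
    by rewrite (maxn_idPr (leqW mn)) mulr1 exprS; ring.
  by rewrite (maxn_idPl mn) mulr0 addr0.
have -> : (fun n => \sum_(0 <= i < n + m) (1 - s) * s ^+ i * (m <= i)%N%:R) =
    (fun n => s ^+ m - s ^+ n * s ^+ m).
  by apply/funext => n; rewrite E (maxn_idPr (leq_addl _ _)) exprD.
rewrite -[X in _ --> X]subr0; apply: cvgB; first exact: cvg_cst.
rewrite -[X in _ --> X](mul0r (s ^+ m)); apply: cvgM; last exact: cvg_cst.
by apply: cvg_expr; rewrite ger0_norm.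
Qed.

Lemma eseries_initial (a : nat -> R) (g : R) m :
  (\sum_(0 <= n <oo) (a n * (n <= m)%N%:R * g)%:E = ((\sum_(n < m.+1) a n) * g)%:E)%E.
Proof.
apply: (@eseries_EFin_cvg _ m.+1).
have -> : (fun n => \sum_(0 <= i < n + m.+1) a i * (i <= m)%N%:R * g) =
    (fun=> (\sum_(n < m.+1) a n) * g); last exact: cvg_cst.
apply/funext; elim => [|n IH].
  rewrite add0n big_mkord mulr_suml; apply: eq_bigr => i _.
  by rewrite -ltnS ltn_ord mulr1.
by rewrite addSn big_nat_recr//= IH leqNgt addnS ltnS leq_addl mulr0 mul0r addr0.
Qed.

Lemma sum_geometric (q : R) m : q != 1 -> \sum_(n < m) q ^+ n = (q ^+ m - 1) / (q - 1).
Proof. by move=> q1; rewrite subrX1 mulrAC mulfV ?mul1r// subr_eq0. Qed.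

End Series.

Lemma integral_scaleK d (T : measurableType d) (R : realType) (mu : {measure set T -> \bar R})
  (D : set T) (c : R) (H : T -> \bar R) : measurable D -> measurable_fun D H ->
  (forall x, D x -> 0 <= H x)%E -> c != 0 ->
  (c%:E * \int[mu]_(x in D) (c^-1%:E * H x) = \int[mu]_(x in D) H x)%E.
Proof.
move=> mD mH H0; rewrite neq_lt => /orP[] c0.
  have c1 : 0 <= - c^-1 by rewrite oppr_ge0 invr_le0 ltW.
  under eq_integral do rewrite -[c^-1]opprK EFinN mulNe.
  rewrite integral_ge0N; last by move=> x Dx; rewrite mule_ge0 ?H0.
  rewrite ge0_integralZl_EFin// muleN -mulNe muleA -EFinN -EFinM mulrNN.
  by rewrite mulfV ?mul1e// lt_eqF.
rewrite ge0_integralZl_EFin ?invr_ge0 ?(ltW c0)// muleA -EFinM.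
by rewrite mulfV ?mul1e// gt_eqF.
Qed.

(** * Duality between balls and termwise integration of the two series *)

Section BallDuality.
Variables (R : realType) (K : fieldType) (p : nat) (absp : K -> R) (N : nat).
Hypothesis HQp : qp_is_Qp p absp.
Hypothesis HN : (0 < N)%N.

Local Notation V := (qp_QpN R K absp N).
Local Notation normp := (@qp_normp R K absp N).
Local Notation vsub := (@qp_vsub K N).
Local Notation ball := (@qp_ball R K absp N).
Local Notation v0 := (@qp_vzero R K absp N).
Local Notation B n := (ball v0 (p%:R ^- n)).
Local Notation B' n := (ball v0 (p%:R ^+ n)).

Let pX_gt0 n : 0 < (p%:R : R) ^+ n. Proof. by rewrite exprn_gt0 ?(p_gt0 HQp). Qed.
Let pXV_gt0 n : 0 < (p%:R : R) ^- n. Proof. by rewrite invr_gt0. Qed.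

Let mB n : measurable (B n). Proof. exact: (qp_ball_measurable HQp). Qed.
Let mB' n : measurable (B' n). Proof. exact: (qp_ball_measurable HQp). Qed.

Let pK_X n : (p%:R : K) ^+ n != 0. Proof. by rewrite expf_neq0// (pK_neq0 HQp). Qed.

Let cB n : @qp_compactp R K absp N (B n).
Proof. by rewrite -(absp_pX HQp); exact: (qp_ball_compact HQp). Qed.

Let cB' n : @qp_compactp R K absp N (B' n).
Proof.
rewrite -[p%:R ^+ n]invrK -(absp_pX HQp) -(abspV HQp).
by apply: (qp_ball_compact HQp); rewrite invr_neq0.
Qed.

Lemma qp_testfun_ball n : qp_testfun (fun x : V => (\1_(B n) x)%:C%C : R[i]).
Proof.
split; last first.
  by exists (B n); [exact: cB|move=> x /= hx; rewrite indicE memNset].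
move=> x; exists (p%:R ^- n) => // y yx; rewrite !indicE; congr ((_ : nat)%:R)%:C%C.
congr nat_of_bool; apply/idP/idP; rewrite !inE.
  by apply: (normp_vsub_trans HQp); rewrite (normp_vsubC HQp) ltW.
by apply: (normp_vsub_trans HQp); exact: ltW.
Qed.

Lemma measurable_set1_vzero : measurable [set v0 : V].
Proof.
rewrite -[X in measurable X]setCK; apply: measurableC; apply: qp_open_measurable => x /= x0.
exists (normp x); first exact: (normp_gt0 HQp).
move=> y yx /= y0; move: yx; rewrite y0 (normp_vsubC HQp) (normp_vsub0 _) ltxx//.
Qed.

(** At such a point the series over the balls [B n] stops at the index [m], leaving a finite sum of
    [a n]. *)
Lemma normp_le1_expN (x : V) : x <> v0 -> normp x <= 1 ->
  exists m : nat, normp x = p%:R ^- m /\ forall n, (x \in B n) = (n <= m)%N.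
Proof.
move=> x0 x1; have [z e] := normp_expz HQp x0; have p1 := p_gt1 HQp.
have [m em] : exists m : nat, z = - m%:Z.
  move: x1; rewrite e -(expr0z p%:R) ler_eXz2l// => z0; exists `|z|%N.
  by rewrite abszE ler0_norm// opprK.
have {}e : normp x = p%:R ^- m by rewrite e em exprnN.
exists m; split => // n; apply/idP/idP.
  rewrite inE qp_ball0E /= e lef_pV2 ?posrE// ler_eXn2l//.
by move=> nm; rewrite inE qp_ball0E /= e lef_pV2 ?posrE// ler_eXn2l.
Qed.

(** Dual counterpart: here the balls grow, so the series over [B' n] becomes a tail starting at
    [m]. *)
Lemma max1_normp_expn (x : V) :
  exists m : nat, Num.max 1 (normp x) = p%:R ^+ m /\ forall n, (x \in B' n) = (m <= n)%N.
Proof.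
have p1 := p_gt1 HQp.
have [x1|x1] := leP (normp x) 1.
  exists 0%N; split => // n; rewrite leq0n; apply/mem_set; rewrite qp_ball0E /=.
  by rewrite (le_trans x1)// exprn_ege1// ltW.
have x0 : x <> v0 by move=> h; move: x1; rewrite h (normp0 _ HQp) ltr10.
have [z e] := normp_expz HQp x0.
have [m em] : exists m : nat, z = m%:Z.
  move: x1; rewrite e -(expr0z p%:R) ltr_eXz2l// => z0; exists `|z|%N.
  by rewrite abszE ger0_norm// ltW.
have {}e : normp x = p%:R ^+ m by rewrite e em.
exists m; split => // n; apply/idP/idP.
  rewrite inE qp_ball0E /= e ler_eXn2l//.
by move=> nm; rewrite inE qp_ball0E /= e ler_eXn2l.
Qed.

Variables (lam mu : {measure set V -> \bar R}) (f : V -> R).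
Hypotheses (Hlam : qp_haar_measure lam) (Hmu : qp_regular_measure mu).
Hypothesis Hf0 : forall x, x <> v0 -> 0 <= f x.
Hypothesis Hfloc : qp_locally_integrable lam f.
Hypothesis HF : qp_is_fourier_of_measure p lam f mu.

(** The origin lies in balls of measure [p ^ -(n N)], which tends to 0 since [N > 0]. *)
Lemma haar_set1_vzero : lam [set v0] = 0%E.
Proof.
apply/eqP; rewrite eq_le measure_ge0 andbT; apply/lee_addgt0Pr => e e0; rewrite add0e.
have [n hn] := absp_mul_pX_small HQp 1 e0.
apply: (@le_trans _ _ (lam (B n))).
  apply: le_measure; rewrite ?inE//; first exact: measurable_set1_vzero.
  by move=> _ ->; rewrite qp_ball0E /= (normp0 _ HQp) ltW.
rewrite (haar_ball_pX HQp Hlam) lee_fin ltW// -(absp_pX HQp) -[_ ^+ _]mul1r hn//.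
by rewrite leq_pmulr.
Qed.

Lemma integrable_ball n : lam.-integrable (B n) (EFin \o f).
Proof. by apply: Hfloc; [exact: cB|exact: mB]. Qed.

(** The Fourier hypothesis compares real-valued integrals, where [fine] erases infinities. Local
    integrability of [f] and finiteness of [mu] on the compact [B' n] allow the identity to be
    lifted to the extended reals. *)
Lemma integral_ball_duality n :
  (\int[lam]_(x in B n) (f x)%:E = (p%:R ^- (n * N))%:E * mu (B' n))%E.
Proof.
have fB : mu (B' n) \is a fin_num.
  by rewrite ge0_fin_numE//; case: Hmu => h _ _; apply: h; exact: cB'.
have := HF (qp_testfun_ball n).
rewrite (funext (qp_fourier_ball HQp Hlam n)) => /(congr1 (@complex.Re R)).
rewrite /qp_pair_fun /qp_Cint /=.
under eq_Rintegral do rewrite mul0r subr0.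
have -> : \int[lam]_x (f x * \1_(B n) x) = \int[lam]_(x in B n) f x.
  rewrite [RHS]Rintegral_mkcond; apply: eq_Rintegral => x _; rewrite patchE indicE.
  by case: ifP; rewrite ?mulr1 ?mulr0.
have -> : \int[mu]_x (p%:R ^- (n * N) * \1_(B' n) x) = p%:R ^- (n * N) * fine (mu (B' n)).
  rewrite -Rintegral_cst// [RHS]Rintegral_mkcond; apply: eq_Rintegral => x _.
  by rewrite patchE indicE; case: ifP; rewrite ?mulr1 ?mulr0.
move=> h; rewrite -[LHS]fineK; last exact: integrable_fin_num (integrable_ball n).
by rewrite [X in X%:E]h EFinM fineK.
Qed.

(* [f] may be negative at the null point [v0]. *)
Let g x := Num.max 0 (f x).

Let gE x : x <> v0 -> g x = f x. Proof. by move=> /Hf0 h; rewrite /g max_r. Qed.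
Let g0 x : 0 <= g x. Proof. by rewrite /g le_max lexx. Qed.

Let eq_integral_off0 (D : set V) (u v : V -> \bar R) : measurable D ->
  measurable_fun D u -> measurable_fun D v -> (forall x, D x -> x <> v0 -> u x = v x) ->
  (\int[lam]_(x in D) u x = \int[lam]_(x in D) v x)%E.
Proof.
move=> mD mu' mv uv; apply: ae_eq_integral => //.
exists [set v0]; split; [exact: measurable_set1_vzero|exact: haar_set1_vzero|].
by move=> x /= h; apply: contrapT => x0; apply: h => Dx; exact: uv.
Qed.

Let mf n : measurable_fun (B n) f.
Proof. by apply/measurable_EFinP; have /integrableP[] := integrable_ball n. Qed.

Let mg n : measurable_fun (B n) g.
Proof. by apply: measurable_maxr => //; exact: mf. Qed.

Let sub0 n : B n `<=` B 0.
Proof.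
move=> x; rewrite !qp_ball0E /= => h; rewrite (le_trans h)// expr0 invr1.
by rewrite invf_le1// exprn_ege1// ltW// (p_gt1 HQp).
Qed.

Let mterm (a : nat -> R) n : measurable_fun (B 0) (fun x => (a n * \1_(B n) x * g x)%:E).
Proof.
apply/measurable_EFinP; apply: measurable_funM; last exact: mg.
by apply: measurable_funM => //; exact: measurable_indic.
Qed.

(** Monotone convergence, then the ball duality in each term. Using [g] makes the terms nonnegative
    at every point, the origin included. *)
Lemma integral_ball_series (a : nat -> R) : (forall n, 0 <= a n) ->
  (\int[lam]_(x in B 0) (\sum_(0 <= n <oo) (a n * \1_(B n) x * g x)%:E) =
   \sum_(0 <= n <oo) ((a n * p%:R ^- (n * N))%:E * mu (B' n)))%E.
Proof.
move=> a0; rewrite integral_nneseries//; last first.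
  by move=> n x _; rewrite lee_fin !mulr_ge0.
apply: eq_eseriesr => n _.
have e0 x : B 0 x -> (a n * \1_(B n) x * g x)%:E = ((a n)%:E * (\1_(B n) x * g x)%:E)%E.
  by move=> _; rewrite -mulrA EFinM.
rewrite (eq_integral (fun x => ((a n)%:E * (\1_(B n) x * g x)%:E)%E)); last first.
  by move=> x; rewrite inE; exact: e0.
rewrite ge0_integralZl_EFin//; last 2 first.
- by move=> x _; rewrite lee_fin mulr_ge0.
- have := @mterm (fun=> 1) n; by under eq_fun do rewrite mul1r.
rewrite EFinM -muleA -integral_ball_duality; congr (_ * _)%E.
transitivity (\int[lam]_(x in B n) (g x)%:E)%E.
  rewrite -[in RHS](setIidr (@sub0 n)) integral_mkcondr; apply: eq_integral => x _.
  by rewrite patchE indicE; case: ifP; rewrite ?mul1r ?mul0r.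
apply: eq_integral_off0 => //.
- by apply/measurable_EFinP; exact: mg.
- by apply/measurable_EFinP; exact: mf.
- by move=> x _ x0; rewrite gE.
Qed.

(** Both cases of the theorem at once: [c * k] only has to match the partial sums of [a] on spheres
    of radius [p ^ -m], so nothing is asked of [k] at the origin. *)
Lemma integral_kernel (a : nat -> R) (k : V -> R) (c : R) : (forall n, 0 <= a n) -> c != 0 ->
  (forall x m, normp x = p%:R ^- m -> \sum_(n < m.+1) a n = c * k x) ->
  (c%:E * \int[lam]_(x in B 0) (k x * f x)%:E =
   \sum_(0 <= n <oo) ((a n * p%:R ^- (n * N))%:E * mu (B' n)))%E.
Proof.
move=> a0 c0 ak; rewrite -integral_ball_series//.
set H := fun x : V => (\sum_(0 <= n <oo) (a n * \1_(B n) x * g x)%:E)%E.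
have H0 x : (B 0 x -> 0 <= H x)%E.
  by move=> _; apply: nneseries_ge0 => n _ _; rewrite lee_fin !mulr_ge0.
have mH : measurable_fun (B 0) H.
  apply: (@ge0_emeasurable_sum _ _ _ _ (fun n x => (a n * \1_(B n) x * g x)%:E) xpredT) => //.
  by move=> n x _ _; rewrite lee_fin !mulr_ge0.
rewrite -(integral_scaleK lam (mB 0) mH H0 c0); congr (_ * _)%E.
have HE x : B 0 x -> x <> v0 -> (c^-1%:E * H x = (k x * f x)%:E)%E.
  move=> Bx x0; have [|m [e hm]] := normp_le1_expN x0.
    by move: Bx; rewrite qp_ball0E /= expr0 invr1.
  rewrite /H; under eq_eseriesr do rewrite indicE hm.
  by rewrite eseries_initial (ak x m e) gE// -EFinM !mulrA mulVf// mul1r.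
have mcH : measurable_fun (B 0) (fun x => (c^-1%:E * H x)%E).
  by apply: emeasurable_funM => //; exact: measurable_cst.
have v0B : [set v0] `<=` B 0.
  by move=> _ ->; rewrite qp_ball0E /= (normp0 _ HQp) ltW.
apply: eq_integral_off0 => //; last by move=> x Bx x0; rewrite HE.
(* Measurability of [k * f] is inherited from the series: off the origin it equals [c^-1 * H], and
   on a single point any function is measurable. *)
have m0 := measurable_set1_vzero.
rewrite -(setDUK v0B); apply/measurable_funU => //; first exact: measurableD.
split; first exact: measurable_fun_set1.
apply: (eq_measurable_fun (fun x => (c^-1%:E * H x)%E)).
  by move=> x; rewrite inE => -[Bx x0]; exact: HE.
by apply: measurable_funS mcH => //; exact: subDsetl.
Qed.

Lemma integral_max_series (s : R) : 0 <= s < 1 ->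
  (\int[mu]_x (\sum_(0 <= n <oo) ((1 - s) * s ^+ n * \1_(B' n) x)%:E) =
   \sum_(0 <= n <oo) (((1 - s) * s ^+ n)%:E * mu (B' n)))%E.
Proof.
move=> /andP[s0 s1]; have b0 n : 0 <= (1 - s) * s ^+ n by rewrite mulr_ge0 ?exprn_ge0 ?subr_ge0 ?(ltW s1).
rewrite integral_nneseries//; last 2 first.
- move=> n; apply/measurable_EFinP; apply: measurable_funM => //; exact: measurable_indic.
- by move=> n x _; rewrite lee_fin mulr_ge0.
apply: eq_eseriesr => n _; under eq_integral do rewrite EFinM.
rewrite ge0_integralZl_EFin//; first by rewrite integral_indic// setIT.
by apply/measurable_EFinP; exact: measurable_indic.
Qed.

End BallDuality.

(** * Real powers and the final identification of the kernels *)

Lemma powR_expn (R : realType) (x r : R) m : 0 <= x -> (x ^+ m) `^ r = (x `^ r) ^+ m.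
Proof. by move=> x0; rewrite -powR_mulrn// -powRrM mulrC powRrM powR_mulrn// powR_ge0. Qed.

Lemma powRV (R : realType) (x r : R) : 0 <= x -> x^-1 `^ r = (x `^ r)^-1.
Proof. by move=> x0; rewrite -powR_inv1// -powRrM mulN1r powRN. Qed.

Unset Implicit Arguments.
Set Strict Implicit.

Theorem theorem4 (R : realType) (K : fieldType) (p : nat) (absp : K -> R)
  (HQp : qp_is_Qp p absp) (N : nat) (HN : (0 < N)%N)
  (lam : {measure set (qp_QpN R K absp N) -> \bar R}) (Hlam : qp_haar_measure lam)
  (mu : {measure set (qp_QpN R K absp N) -> \bar R}) (Hmu : qp_regular_measure mu)
  (f : qp_QpN R K absp N -> R)
  (Hf0 : forall x, x <> @qp_vzero R K absp N -> 0 <= f x)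
  (Hfc : qp_continuous_off0 f)
  (Hfloc : qp_locally_integrable lam f)
  (Hpd : qp_posdef_fun lam f)
  (HF : qp_is_fourier_of_measure p lam f mu)
  (d : nat) (Hd : (1 <= d)%N) (beta : R) (Hbeta : 0 < beta) :
  ((\int[mu]_x (((Num.max 1 (qp_normp absp x)) `^ (d%:R * beta))^-1)%R%:E < +oo)%E <->
   (if d%:R * beta != N%:R then
      (((1 - p%:R `^ (- (d%:R * beta))) / (1 - p%:R `^ (d%:R * beta - N%:R)))%R%:E *
         \int[lam]_(x in [set x | (qp_normp absp x <= 1)%R])
            ((qp_normp absp x `^ (d%:R * beta - N%:R) - p%:R `^ (d%:R * beta - N%:R)) * f x)%R%:E
       < +oo)%E
    else
      ((1 - p%:R `^ (- N%:R))%R%:E *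
         \int[lam]_(x in [set x | (qp_normp absp x <= 1)%R])
            ((ln (p%:R / qp_normp absp x) / ln p%:R) * f x)%R%:E
       < +oo)%E)).
Proof.
have p0 := p_gt0 HQp; have p1 := p_gt1 HQp.
set al := d%:R * beta.
have al0 : 0 < al by rewrite mulr_gt0// ltr0n.
set s := p%:R `^ (- al).
have sE : s = (p%:R `^ al)^-1 by rewrite /s powRN.
have s0 : 0 < s by rewrite powR_gt0.
have s1 : s < 1.
  by rewrite /s /powR gt_eqF// expR_lt1 mulNr oppr_lt0 mulr_gt0// ln_gt0.
have -> : (\int[mu]_x (((Num.max 1 (qp_normp absp x)) `^ al)^-1)%R%:E =
    \sum_(0 <= n <oo) (((1 - s) * s ^+ n)%:E * mu (qp_ball (@qp_vzero R K absp N) (p%:R ^+ n))))%E.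
  rewrite -(integral_max_series HQp mu); last by rewrite ltW.
  apply: eq_integral => x _; have [m [-> hm]] := max1_normp_expn HQp x.
  under eq_eseriesr do rewrite indicE hm.
  by rewrite eseries_geometric_tail ?ltW// powR_expn ?ltW// sE exprVn.
(* The ratio of the coefficients [a n], equal to [p ^ (N - al)]; thus [d * beta = N] means
   [q = 1]. *)
set q := p%:R ^+ N * s.
have q0 : 0 < q by rewrite mulr_gt0// exprn_gt0.
have sumE : (\sum_(0 <= n <oo) (((1 - s) * s ^+ n)%:E * mu (qp_ball (@qp_vzero R K absp N) (p%:R ^+ n))) =
   \sum_(0 <= n <oo) (((1 - s) * q ^+ n * p%:R ^- (n * N))%:E * mu (qp_ball (@qp_vzero R K absp N) (p%:R ^+ n))))%E.
  apply: eq_eseriesr => n _; congr (_%:E * _)%E.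
  have pnN : (p%:R : R) ^+ (n * N) != 0 by rewrite expf_neq0// gt_eqF.
  rewrite /q exprMn -exprM (mulnC N); move: pnN; move: (p%:R ^+ _) (s ^+ n) => u v u0.
  by field.
have a0 n : 0 <= (1 - s) * q ^+ n.
  by rewrite mulr_ge0 ?subr_ge0 ?(ltW s1)// exprn_ge0// ltW.
have B0 : [set x | (qp_normp absp x <= 1)%R] = qp_ball (@qp_vzero R K absp N) (p%:R ^- 0).
  by rewrite expr0 invr1 qp_ball0E.
have kernel (k : qp_QpN R K absp N -> R) c : c != 0 ->
    (forall x m, qp_normp absp x = p%:R ^- m -> \sum_(n < m.+1) (1 - s) * q ^+ n = c * k x) ->
    (c%:E * \int[lam]_(x in [set x | (qp_normp absp x <= 1)%R]) (k x * f x)%:E =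
     \sum_(0 <= n <oo) (((1 - s) * s ^+ n)%:E * mu (qp_ball (@qp_vzero R K absp N) (p%:R ^+ n))))%E.
  move=> c0 ck; rewrite sumE B0.
  exact: (integral_kernel HQp HN Hlam Hmu Hf0 Hfloc HF a0 c0 ck).
have qE : p%:R `^ (al - N%:R) = q^-1.
  rewrite powRD; last by rewrite (gt_eqF p0) implybT.
  by rewrite powRN powR_mulrn ?ltW// /q sE invfM invrK mulrC.
case: ifP => [alN|/negbFE/eqP alN].
  have q1 : q != 1.
    rewrite -invr_eq1 -qE; apply: contra_neq alN => /(congr1 (@ln R)).
    rewrite ln_powR ln1 => /eqP; rewrite mulf_eq0 (gt_eqF (ln_gt0 p1)) orbF subr_eq0.
    by move/eqP.
  have q1' : 1 - q^-1 != 0 by rewrite subr_eq0 eq_sym invr_eq1.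
  rewrite kernel//.
    by rewrite qE mulf_neq0 ?invr_eq0// subr_eq0 gt_eqF.
  (* With [normp x = p ^ -m] the kernel is [q ^ m - q^-1], and dividing by [1 - q^-1] gives
     [(q ^ (m+1) - 1) / (q - 1)], the sum of [m + 1] powers of [q]. *)
  move=> x m ->; rewrite -mulr_sumr sum_geometric// powRV ?exprn_ge0 ?ltW//.
  rewrite powR_expn ?ltW// qE exprVn invrK exprS.
  by field; rewrite ?subr_eq0 ?q1 ?gt_eqF.
have q1 : q = 1.
  by apply: invr_inj; rewrite -qE alN subrr powRr0 invr1.
rewrite -alN kernel//; first by rewrite subr_eq0 gt_eqF.
(* All powers of [q] are 1, so the logarithm [log_p (p / normp x) = m + 1] counts the balls [B 0],
   ..., [B m] that contain [x]. *)
move=> x m ->; rewrite -mulr_sumr q1; under eq_bigr do rewrite expr1n.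
rewrite sumr_const card_ord invrK -exprS lnXn// -[ln _ *+ _]mulr_natl mulfK//.
by rewrite gt_eqF// ln_gt0.
Qed.
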